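(* Let $H$ be a non-empty connected graph. Then for every non-empty, irreflexive and connected graph $G$, $$\mathrm{comp}(G\to H)=\sum_{J\in\mathcal{S}_H}\lambda_H(J)\,\hom(G\to J),$$ where $\mathrm{comp}(G\to H)$ is the number of compactions from $G$ to $H$ and $\hom(G\to J)$ the number of homomorphisms from $G$ to $J$.
   Context: Graphs are finite, undirected, possibly with loops; irreflexive means no loops; non-empty means at least one vertex. A homomorphism $h:V(G)\to V(H)$ maps each edge of $G$ to an edge of $H$; a compaction is a homomorphism that uses every vertex of $H$ and every non-loop edge of $H$ (it uses an edge $\{w_1,w_2\}$ if some edge $\{u_1,u_2\}$ of $G$ has $h(u_1)=w_1,h(u_2)=w_2$). A subgraph $H'$ of $H$ is loop-hereditary if every vertex of $H'$ that has a loop in $H$ also has a loop in $H'$. For connected $H$, $\mathrm{Sub}(H)$ is the set of non-empty, loop-hereditary, connected subgraphs of $H$; $\mathcal{S}_H$ is a set containing exactly one representative of each isomorphism class of graphs in $\mathrm{Sub}(H)$; for $H'\in\mathcal{S}_H$, $\mu_H(H')$ is the number of graphs in $\mathrm{Sub}(H)$ isomorphic to $H'$. For each non-empty connected graph $H$ a weight $\lambda_H(J)\in\mathbb{Z}$ is defined for every non-empty connected graph $J$ by: $\lambda_H(J)=0$ if $J$ is isomorphic to no graph in $\mathcal{S}_H$; $\lambda_H(J)=1$ if $J\cong H$; otherwise (inductively, on graphs smaller than $H$ in number of vertices, then number of edges) $\lambda_H(J)=-\sum_{H'\in\mathcal{S}_H,\ H'\not\cong H}\mu_H(H')\lambda_{H'}(J)$.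 *)

(* Defs.v *)
From HB Require Import structures.
From mathcomp Require Import all_boot all_order all_algebra.
Set Implicit Arguments.
Unset Strict Implicit.
Unset Printing Implicit Defensive.
Import GRing.Theory.

Record lgraph := LGraph {
  vert :> finType;
  edge : rel vert;
  edge_sym : symmetric edge }.

Definition nonempty (G : lgraph) : bool := 0 < #|G|.
Definition irreflexive_graph (G : lgraph) : bool := [forall x : G, ~~ edge x x].
Definition connected (G : lgraph) : bool :=
  [forall x : G, forall y : G, connect (@edge G) x y].

Definition is_hom (G H : lgraph) (h : {ffun G -> H}) : bool :=
  [forall u : G, forall v : G, edge u v ==> edge (h u) (h v)].

Definition uses_vertex (G H : lgraph) (h : {ffun G -> H}) (w : H) : bool :=
  [exists u : G, h u == w].

Definition uses_edge (G H : lgraph) (h : {ffun G -> H}) (w1 w2 : H) : bool :=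
  [exists u1 : G, exists u2 : G, [&& edge u1 u2, h u1 == w1 & h u2 == w2]].

Definition is_compaction (G H : lgraph) (h : {ffun G -> H}) : bool :=
  [&& is_hom h,
      [forall w : H, uses_vertex h w] &
      [forall w1 : H, forall w2 : H,
         edge w1 w2 && (w1 != w2) ==> uses_edge h w1 w2]].

Definition num_hom (G H : lgraph) : nat := #|[set h : {ffun G -> H} | is_hom h]|.
Definition num_comp (G H : lgraph) : nat :=
  #|[set h : {ffun G -> H} | is_compaction h]|.

Definition is_iso (G H : lgraph) (f : {ffun G -> H}) : bool :=
  [&& injectiveb f, [forall y : H, y \in codom f] &
      [forall u : G, forall v : G, edge u v == edge (f u) (f v)]].
Definition iso (G H : lgraph) : bool := [exists f : {ffun G -> H}, is_iso f].

(* An undirected edge set is encoded by its symmetric set of ordered pairs, so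
   each subgraph of H is represented by exactly one term of [subgraph H]. *)
Definition is_subgraph (H : lgraph) (p : {set H} * {set H * H}) : bool :=
  [forall x : H, forall y : H, ((x, y) \in p.2) ==>
     [&& edge x y, x \in p.1, y \in p.1 & (y, x) \in p.2]].

Record subgraph (H : lgraph) := Subgraph {
  sub_pair : {set H} * {set H * H};
  sub_pairP : is_subgraph sub_pair }.

HB.instance Definition _ (H : lgraph) := [isSub for @sub_pair H].
HB.instance Definition _ (H : lgraph) := [Finite of subgraph H by <:].

Definition sub_verts (H : lgraph) (K : subgraph H) : {set H} := (sub_pair K).1.
Definition sub_edges (H : lgraph) (K : subgraph H) : {set H * H} :=
  (sub_pair K).2.

Definition sub_rel (H : lgraph) (K : subgraph H) : rel {x : H | x \in sub_verts K} :=
  fun x y => (val x, val y) \in sub_edges K.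

Lemma sub_rel_sym (H : lgraph) (K : subgraph H) : symmetric (@sub_rel H K).
Proof.
have sE x y : (x, y) \in sub_edges K -> (y, x) \in sub_edges K.
  move=> xy; have /forallP/(_ x)/forallP/(_ y) := sub_pairP K.
  by rewrite -/(sub_edges K) xy => /and4P[].
by move=> x y; apply/idP/idP => /sE.
Qed.

Definition graph_of (H : lgraph) (K : subgraph H) : lgraph :=
  LGraph (@sub_rel_sym H K).
Coercion graph_of : subgraph >-> lgraph.

Definition loop_hereditary (H : lgraph) (K : subgraph H) : bool :=
  [forall x in sub_verts K, edge x x ==> ((x, x) \in sub_edges K)].

Definition SubG (H : lgraph) : {set subgraph H} :=
  [set K : subgraph H | [&& nonempty K, loop_hereditary K & connected K]].

Definition is_reps (H : lgraph) (S : {set subgraph H}) : Prop :=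
  S \subset SubG H /\
  forall K : subgraph H, K \in SubG H -> exists! K' : subgraph H, K' \in S /\ iso K K'.

Definition mu (H : lgraph) (H' : subgraph H) : nat :=
  #|[set K in SubG H | iso K H']|.

Definition gsize (H : lgraph) : nat :=
  #|H| + #|[set p : H * H | edge p.1 p.2]|.

(* S H plays the role of the chosen set of representatives for H, and n
   is recursion fuel: [lambdaE] below shows that [gsize H] is enough. *)
Fixpoint lambda_rec (S : forall H : lgraph, {set subgraph H}) (n : nat)
    (H J : lgraph) : int :=
  if ~~ [exists K : subgraph H, (K \in S H) && iso J K] then 0%R
  else if iso J H then 1%R
  else if n is n'.+1 then
    (- \sum_(H' in S H | ~~ iso H' H) (mu H')%:Z * lambda_rec S n' H' J)%R
  else 0%R.

Definition lambda (S : forall H : lgraph, {set subgraph H}) (H J : lgraph) : int :=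
  lambda_rec S (gsize H) H J.

Lemma sub_edgesP (H : lgraph) (K : subgraph H) x y : (x, y) \in sub_edges K ->
  [/\ edge x y, x \in sub_verts K & y \in sub_verts K].
Proof.
move=> xy; have /forallP/(_ x)/forallP/(_ y) := sub_pairP K.
by rewrite -/(sub_edges K) xy => /and4P[].
Qed.

Lemma card_sub_edges (H : lgraph) (K : subgraph H) :
  #|[set p : K * K | edge p.1 p.2]| = #|sub_edges K|.
Proof.
pose f (p : K * K) : H * H := (val p.1, val p.2).
have f_inj : injective f by move=> [a b] [c d] [/val_inj-> /val_inj->].
rewrite -(card_imset _ f_inj); congr #|pred_of_set _|; apply/setP => -[x y].
apply/imsetP/idP => [[[a b]]|xy]; first by rewrite inE => ab [-> ->].
have [_ xK yK] := sub_edgesP xy.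
by exists (Sub x xK : K, Sub y yK : K); rewrite ?inE.
Qed.

Lemma gsize_sub (H : lgraph) (K : subgraph H) : ~~ iso K H -> gsize K < gsize H.
Proof.
set E := [set p : H * H | edge p.1 p.2].
have cV : #|K| = #|sub_verts K| by rewrite card_sig.
have sE : sub_edges K \subset E.
  by apply/subsetP => -[x y] /sub_edgesP[]; rewrite inE.
rewrite /gsize card_sub_edges cV -/E; apply: contraR.
rewrite -leqNgt => le.
have leV := max_card (mem (sub_verts K)); have leE := subset_leq_card sE.
have eqV : sub_verts K = setT.
  apply/eqP; rewrite eqEcard subsetT cardsT.
  by rewrite -(leq_add2r #|E|) (leq_trans le) // leq_add2l.
have eqE : sub_edges K = E.
  apply/eqP; rewrite eqEcard sE /=.
  by rewrite -(leq_add2l #|H|) (leq_trans le) // leq_add2r.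
apply/existsP; exists [ffun x : K => val x : H]; apply/and3P; split.
- by apply/injectiveP => x y; rewrite !ffunE => /val_inj.
- apply/forallP => y; have yK : y \in sub_verts K by rewrite eqV inE.
  by apply/codomP; exists (Sub y yK : K); rewrite ffunE.
- apply/forallP => x; apply/forallP => y; rewrite !ffunE /= /sub_rel eqE inE.
  by [].
Qed.

Lemma lambda_rec_fuel S m n H J : gsize H <= m -> gsize H <= n ->
  lambda_rec S m H J = lambda_rec S n H J.
Proof.
elim: m n H => [|m IHm] [|n] H //= lem len; do 2![case: ifP => // _].
- rewrite big_pred0 ?oppr0 // => K; apply/negP => /andP[_ /gsize_sub].
  by move/leq_trans/(_ lem).
- rewrite big_pred0 ?oppr0 // => K; apply/negP => /andP[_ /gsize_sub].
  by move/leq_trans/(_ len).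
- congr (- _)%R; apply: eq_bigr => K /andP[_ /gsize_sub lt].
  by rewrite (IHm n) // -ltnS (leq_trans lt).
Qed.

Lemma lambdaE S H J : lambda S H J =
  if ~~ [exists K : subgraph H, (K \in S H) && iso J K] then 0%R
  else if iso J H then 1%R
  else (- \sum_(H' in S H | ~~ iso H' H) (mu H')%:Z * lambda S H' J)%R.
Proof.
rewrite {1}/lambda (@lambda_rec_fuel S _ (gsize H).+1) //=.
do 2![case: ifP => // _]; congr (- _)%R; apply: eq_bigr => K /andP[_ /gsize_sub lt].
by congr (_ * _)%R; apply: lambda_rec_fuel => //; apply: ltnW.
Qed.

Lemma isoP (G H : lgraph) :
  reflect (exists f : G -> H, bijective f /\ forall u v, edge u v = edge (f u) (f v))
          (iso G H).
Proof.
apply: (iffP existsP) => [[f /and3P[/injectiveP fI /forallP fS /forallP fE]]|].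
  exists f; split; last by move=> u v; apply/eqP; move/forallP: (fE u).
  by exists (fun y => iinv (fS y)) => x; rewrite ?f_iinv //; apply: fI; rewrite f_iinv.
move=> [f [[g fK gK] fE]]; exists (finfun f); apply/and3P; split.
- by apply/injectiveP => x y; rewrite !ffunE; apply: can_inj fK _ _.
- by apply/forallP => y; apply/codomP; exists (g y); rewrite ffunE gK.
- by apply/forallP => u; apply/forallP => v; rewrite !ffunE fE.
Qed.

Lemma iso_refl (G : lgraph) : iso G G.
Proof. by apply/isoP; exists id; split => //; exists id. Qed.

Lemma iso_sym (G H : lgraph) : iso G H -> iso H G.
Proof.
move=> /isoP[f [[g fK gK] fE]]; apply/isoP; exists g; split; first by exists f.
by move=> u v; rewrite fE !gK.
Qed.

Lemma iso_trans (G H K : lgraph) : iso G H -> iso H K -> iso G K.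
Proof.
move=> /isoP[f [fB fE]] /isoP[g [gB gE]]; apply/isoP; exists (g \o f).
by split; [apply: bij_comp | move=> u v; rewrite fE gE].
Qed.

Lemma reps_exist : exists S : forall H : lgraph, {set subgraph H},
  forall H, is_reps (S H).
Proof.
exists (fun H => [set K in SubG H | [pick K' in SubG H | iso K K'] == Some K]).
move=> H; split=> [|K KS]; first by apply/subsetP => K; rewrite inE => /andP[].
have pickE (A B : subgraph H) : iso A B ->
    [pick K' in SubG H | iso A K'] = [pick K' in SubG H | iso B K'].
  move=> AB; apply: eq_pick => C /=; congr (_ && _); apply/idP/idP.
    by apply: iso_trans; apply: iso_sym.
  exact: iso_trans.
case E: [pick K' in SubG H | iso K K'] => [K'|]; last first.
  by move: E; case: pickP => // /(_ K); rewrite KS iso_refl.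
have /andP[K'S KK'] : (K' \in SubG H) && iso K K'.
  by move: E; case: pickP => // L ? [<-].
exists K'; split=> [|L []]; first by rewrite inE K'S -(pickE _ _ KK') E eqxx.
by rewrite inE => /andP[_ /eqP +] KL; rewrite -(pickE _ _ KL) E => -[].
Qed.

(* Main.v *)
(** Every homomorphism from a connected [G] to [H] is a compaction onto exactly one
    graph of [SubG H], namely its image completed with all loops of [H] on it.
    Hence [hom(G, H)] is the sum over representatives [K] of [mu K * comp(G, K)].
    Since [H] itself occurs once, solving for [comp(G, H)] and expanding the other
    terms by induction on [gsize] produces the recursion that defines [lambda];
    the representatives of a subgraph [K] may be replaced by those of [H] because
    [lambda K] is invariant under isomorphism and vanishes off subgraphs of [K]. *)

Require Import Defs.
From mathcomp Require Import all_boot all_order all_algebra.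
Set Implicit Arguments.
Unset Strict Implicit.
Unset Printing Implicit Defensive.
Import GRing.Theory.

(** * Propositional views of the boolean predicates *)

Lemma is_homP (G H : lgraph) (h : {ffun G -> H}) :
  reflect (forall u v, edge u v -> edge (h u) (h v)) (is_hom h).
Proof.
apply: (iffP forallP) => [hom u v|hom u].
  by move/forallP/(_ v)/implyP: (hom u).
by apply/forallP => v; apply/implyP/hom.
Qed.

Lemma uses_edgeP (G H : lgraph) (h : {ffun G -> H}) w1 w2 :
  reflect (exists u1 u2, [/\ edge u1 u2, h u1 = w1 & h u2 = w2])
          (uses_edge h w1 w2).
Proof.
apply: (iffP existsP) => [[u1 /existsP[u2 /and3P[e /eqP<- /eqP<-]]]|].
  by exists u1, u2.
by move=> [u1 [u2 [e <- <-]]]; exists u1; apply/existsP; exists u2; rewrite e !eqxx.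
Qed.

Lemma is_compactionP (G H : lgraph) (h : {ffun G -> H}) :
  reflect [/\ forall u v, edge u v -> edge (h u) (h v),
              forall w, exists u, h u = w &
              forall w1 w2, edge w1 w2 -> w1 != w2 ->
                exists u1 u2, [/\ edge u1 u2, h u1 = w1 & h u2 = w2]]
          (is_compaction h).
Proof.
apply: (iffP and3P) => [[/is_homP hom /forallP sur /forallP ed]|[hom sur ed]].
  split=> // [w|w1 w2 e ne].
    by have /existsP[u /eqP] := sur w; exists u.
  by apply/uses_edgeP; have /forallP/(_ w2) := ed w1; rewrite e ne.
split; first exact/is_homP.
  by apply/forallP => w; apply/existsP; have [u <-] := sur w; exists u.
apply/forallP => w1; apply/forallP => w2; apply/implyP => /andP[e ne].
by apply/uses_edgeP; apply: ed.
Qed.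

Lemma loop_hereditaryP (H : lgraph) (K : subgraph H) :
  reflect (forall x, x \in sub_verts K -> edge x x -> (x, x) \in sub_edges K)
          (loop_hereditary K).
Proof.
apply: (iffP forallP) => [lh x xK e|lh x].
  by have := lh x; rewrite xK e.
by apply/implyP => xK; apply/implyP; apply: lh.
Qed.

Lemma connectedP (G : lgraph) :
  reflect (forall x y : G, connect (@edge G) x y) (connected G).
Proof.
apply: (iffP forallP) => [c x|c x]; first by move/forallP: (c x).
by apply/forallP.
Qed.

Lemma subgraph_eq (H : lgraph) (K L : subgraph H) :
  sub_verts K = sub_verts L -> sub_edges K = sub_edges L -> K = L.
Proof.
move=> eV eE; apply: val_inj; move: eV eE; rewrite /sub_verts /sub_edges /=.
by case: (sub_pair K) (sub_pair L) => [? ?] [? ?] /= -> ->.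
Qed.

(** * Transport along homomorphisms and isomorphisms *)

Lemma connected_surj (G K : lgraph) (f : G -> K) :
  (forall u v, edge u v -> edge (f u) (f v)) -> (forall w, exists u, f u = w) ->
  connected G -> connected K.
Proof.
move=> hom sur /connectedP cG; apply/connectedP => x y.
have [u <-] := sur x; have [v <-] := sur y.
(* A walk between preimages of [x] and [y] maps to a walk from [x] to [y]. *)
have /connectP[p] := cG u v; elim: p u => [|w p IH] u /=; first by move=> _ ->.
by case/andP=> e pp E; apply: connect_trans (connect1 (hom _ _ e)) (IH _ pp E).
Qed.

Lemma nonempty_map (G K : lgraph) (f : G -> K) : nonempty G -> nonempty K.
Proof. by move=> /card_gt0P[x _]; apply/card_gt0P; exists (f x). Qed.

Lemma nonempty_iso (G K : lgraph) : iso G K -> nonempty G -> nonempty K.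
Proof. by move=> /isoP[f _]; apply: nonempty_map. Qed.

Lemma connected_iso (G K : lgraph) : iso G K -> connected G -> connected K.
Proof.
move=> /isoP[f [[g fK gK] fE]]; apply: (@connected_surj _ _ f) => [u v|w].
  by rewrite fE.
by exists (g w).
Qed.

Lemma gsize_iso (G K : lgraph) : iso G K -> gsize G = gsize K.
Proof.
move=> /isoP[f [fB fE]]; rewrite /gsize (bij_eq_card fB); congr (_ + _).
have [g fK gK] := fB.
pose F (p : G * G) := (f p.1, f p.2).
have FI : injective F by move=> [a b] [c d] [/(can_inj fK)-> /(can_inj fK)->].
rewrite -(card_imset _ FI); congr #|pred_of_set _|; apply/setP => -[x y].
apply/imsetP/idP => [[[a b]]|]; first by rewrite !inE => e [-> ->]; rewrite -fE.
by rewrite inE => e; exists (g x, g y); rewrite ?inE /= /F /= ?gK // fE !gK.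
Qed.

Lemma gsize_sub_le (H : lgraph) (K : subgraph H) : gsize K <= gsize H.
Proof.
by have [/gsize_iso->|/gsize_sub/ltnW] := boolP (iso K H).
Qed.

(** Postcomposition with an isomorphism is injective and preserves homomorphisms. One inequality is
    enough, since isomorphism is symmetric. *)
Lemma num_hom_le_iso (G J K : lgraph) : iso J K -> num_hom G J <= num_hom G K.
Proof.
move=> /isoP[f [[g fK gK] fE]].
pose F (h : {ffun G -> J}) : {ffun G -> K} := [ffun u => f (h u)].
have FI : injective F.
  move=> a b /ffunP E; apply/ffunP => u; apply: (can_inj fK).
  by have := E u; rewrite !ffunE.
rewrite /num_hom -(card_imset _ FI); apply/subset_leq_card/subsetP => k /imsetP[h].
rewrite !inE => /is_homP hom ->; apply/is_homP => u v e.
by rewrite !ffunE -fE hom.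
Qed.

Lemma num_hom_iso (G J K : lgraph) : iso J K -> num_hom G J = num_hom G K.
Proof.
move=> i; apply/eqP; rewrite eqn_leq num_hom_le_iso //=.
exact: num_hom_le_iso (iso_sym i).
Qed.

Lemma num_comp_le_iso (G J K : lgraph) : iso J K -> num_comp G J <= num_comp G K.
Proof.
move=> /isoP[f [[g fK gK] fE]].
pose F (h : {ffun G -> J}) : {ffun G -> K} := [ffun u => f (h u)].
have FI : injective F.
  move=> a b /ffunP E; apply/ffunP => u; apply: (can_inj fK).
  by have := E u; rewrite !ffunE.
rewrite /num_comp -(card_imset _ FI); apply/subset_leq_card/subsetP => k /imsetP[h].
rewrite !inE => /is_compactionP[hom sur ed] ->; apply/is_compactionP; split.
- by move=> u v e; rewrite !ffunE -fE hom.
- by move=> w; have [u E] := sur (g w); exists u; rewrite ffunE E gK.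
(* A non-loop edge of [K] is pulled back along [g] to a non-loop edge of [J], which [h] uses. *)
move=> w1 w2 e ne; have [||u1 [u2 [e' E1 E2]]] := ed (g w1) (g w2).
- by rewrite fE !gK.
- by rewrite (can_eq gK).
by exists u1, u2; rewrite !ffunE E1 E2 !gK.
Qed.

Lemma num_comp_iso (G J K : lgraph) : iso J K -> num_comp G J = num_comp G K.
Proof.
move=> i; apply/eqP; rewrite eqn_leq num_comp_le_iso //=.
exact: num_comp_le_iso (iso_sym i).
Qed.

Lemma iso_l (J J' K : lgraph) : iso J J' -> iso J K = iso J' K.
Proof. by move=> i; apply/idP/idP; apply: iso_trans => //; apply: iso_sym. Qed.

(** The graph [J] enters the recursion only through isomorphism tests. The induction is on the fuel
    with [H] generalized, because the recursion moves to subgraphs of [H]. *)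
Lemma lambda_iso (S : forall H : lgraph, {set subgraph H})
    (H J J' : lgraph) : iso J J' -> lambda S H J = lambda S H J'.
Proof.
move=> i; rewrite /lambda; move: (gsize H) => n; elim: n H => [|n IH] H /=;
  rewrite (iso_l H i) (eq_existsb (fun K : subgraph H =>
    congr1 (andb (K \in S H)) (iso_l K i))) //.
by do 2!case: ifP => // _; congr (- _)%R; apply: eq_bigr => K _; rewrite IH.
Qed.

(** * Subgraphs *)

Definition image_pair (G H : lgraph) (h : {ffun G -> H}) : {set H} * {set H * H} :=
  ([set h u | u : G],
   [set p | [&& edge p.1 p.2, p.1 \in [set h u | u : G], p.2 \in [set h u | u : G]
               & (p.1 == p.2) || uses_edge h p.1 p.2]]).

Lemma image_pairP (G H : lgraph) (h : {ffun G -> H}) : is_subgraph (image_pair h).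
Proof.
apply/forallP => x; apply/forallP => y; apply/implyP; rewrite !inE /=.
case/and4P=> e -> -> u; rewrite [edge y x]edge_sym e /=.
rewrite [y == x]eq_sym; case/orP: u => [->//|/uses_edgeP[u1 [u2 [e' E1 E2]]]].
apply/orP; right; apply/uses_edgeP; exists u2, u1.
by rewrite edge_sym.
Qed.

(* Every loop of [H] at a vertex of the image is kept, whether or not [h] uses
   it: this is the only loop-hereditary choice. *)
Definition image_subgraph (G H : lgraph) (h : {ffun G -> H}) : subgraph H :=
  Subgraph (image_pairP h).

(** Restricting the codomain of [h] to its image gives [c]: the only edges kept without being used
    by [h] are loops, and a compaction may miss those. *)
Lemma image_subgraph_compaction (G H : lgraph) (h : {ffun G -> H}) : is_hom h ->
  exists2 c : {ffun G -> image_subgraph h}, is_compaction c &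
    h = [ffun u => val (c u)].
Proof.
move=> /is_homP hom.
have hV u : h u \in sub_verts (image_subgraph h) by apply: imset_f.
exists [ffun u => Sub (h u) (hV u)]; last by apply/ffunP => u; rewrite !ffunE.
apply/is_compactionP; split.
- move=> u v e; rewrite !ffunE /edge /= /sub_rel /= inE /= hom // !imset_f //=.
  by apply/orP; right; apply/uses_edgeP; exists u, v.
- move=> [w wV]; have /imsetP[u _ E] := wV; exists u; rewrite ffunE.
  exact: val_inj.
- move=> [w1 w1V] [w2 w2V]; rewrite -val_eqE /= /sub_rel /= inE /=.
  case/and4P=> e _ _ /orP[->//|/uses_edgeP[u1 [u2 [e' E1 E2]]]] _.
  by exists u1, u2; split; rewrite // ffunE; apply: val_inj.
Qed.

Lemma image_subgraph_SubG (G H : lgraph) (h : {ffun G -> H}) :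
  nonempty G -> connected G -> is_hom h -> image_subgraph h \in SubG H.
Proof.
move=> nG cG hom; have [c /is_compactionP[chom sur _] _] :=
  image_subgraph_compaction hom.
rewrite inE (nonempty_map c nG) (connected_surj chom sur cG) andbT /=.
apply/loop_hereditaryP => x xV e.
by rewrite inE /= e eqxx /= -[_ \in _]/(x \in sub_verts (image_subgraph h)) xV.
Qed.

(** Uniqueness of the target: the non-loop edges of [K] are exactly those used by [c], and its loops
    are all the loops of [H] on its vertices because [K] is loop-hereditary. *)
Lemma compaction_image (G H : lgraph) (K : subgraph H) (c : {ffun G -> K}) :
  loop_hereditary K -> is_compaction c ->
  let h := [ffun u => val (c u)] : {ffun G -> H} in
  is_hom h /\ image_subgraph h = K.
Proof.
move=> /loop_hereditaryP lh /is_compactionP[hom sur ed] h.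
have homK u v : edge u v -> (h u, h v) \in sub_edges K.
  by move=> /hom; rewrite !ffunE.
split; first by apply/is_homP => u v /homK/sub_edgesP[].
have eV : [set h u | u : G] = sub_verts K.
  apply/setP => x; apply/imsetP/idP => [[u _ ->]|xK].
    by rewrite ffunE; apply: valP.
  by have [u E] := sur (Sub x xK); exists u; rewrite // ffunE E.
apply: subgraph_eq => //; apply/setP => -[x y].
rewrite inE /= eV.
apply/idP/idP => [/and4P[e xK yK /orP[/eqP E|]]|xy].
- by rewrite -E in e *; apply: lh.
- by move=> /uses_edgeP[u1 [u2 [e' <- <-]]]; apply: homK.
have [e xK yK] := sub_edgesP xy; rewrite e xK yK /=.
have [//|ne] := eqVneq x y; apply/uses_edgeP.
have [//||u1 [u2 [e' E1 E2]]] := ed (Sub x xK) (Sub y yK).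
  by rewrite -val_eqE.
by exists u1, u2; split; rewrite // ffunE ?E1 ?E2.
Qed.

(** Composition with the inclusion of [K] in [H] is a bijection from the compactions onto [K] to the
    fibre of [image_subgraph] over [K]. *)
Lemma num_hom_image (G H : lgraph) (K : subgraph H) : loop_hereditary K ->
  #|[set h : {ffun G -> H} | is_hom h & image_subgraph h == K]| = num_comp G K.
Proof.
move=> lh; pose F (c : {ffun G -> K}) : {ffun G -> H} := [ffun u => val (c u)].
have FI : injective F.
  move=> a b /ffunP E; apply/ffunP => u; apply: val_inj.
  by have := E u; rewrite !ffunE.
rewrite /num_comp -(card_imset _ FI); congr #|pred_of_set _|; apply/setP => h.
rewrite inE; apply/andP/imsetP => [[hom /eqP E]|[c]].
  subst K; have [c cc hE] := image_subgraph_compaction hom.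
  by exists c; rewrite ?inE.
by rewrite inE => /(compaction_image lh)[hom E] ->; split=> //; apply/eqP.
Qed.

Lemma num_hom_sum_comp (G H : lgraph) : nonempty G -> connected G ->
  num_hom G H = \sum_(K in SubG H) num_comp G K.
Proof.
move=> nG cG; rewrite /num_hom -sum1_card.
rewrite (partition_big (@image_subgraph G H) [in SubG H]) /=; last first.
  by move=> h; rewrite inE; apply: image_subgraph_SubG.
apply: eq_bigr => K; rewrite inE => /and3P[_ lh _].
rewrite -(num_hom_image G lh) -sum1_card; apply: eq_bigl => h.
by rewrite !inE.
Qed.

(** [M] is the image of [L] under the inclusion of [K] in [H]. Loop-heredity is used twice: a loop
    of [H] at a vertex of [L] is first a loop of [K], then a loop of [L]. *)
Lemma SubG_trans (H : lgraph) (K : subgraph H) (L : subgraph K) :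
  K \in SubG H -> L \in SubG K -> exists2 M : subgraph H, M \in SubG H & iso L M.
Proof.
rewrite !inE => /and3P[_ /loop_hereditaryP lhK _] /and3P[nL /loop_hereditaryP lhL cL].
pose V : {set H} := [set val x | x in sub_verts L].
pose E : {set H * H} := [set (val p.1, val p.2) | p in sub_edges L].
have VE (x : K) : (val x \in V) = (x \in sub_verts L).
  by rewrite mem_imset //; apply: val_inj.
have EE (x y : K) : ((val x, val y) \in E) = ((x, y) \in sub_edges L).
  by rewrite (mem_imset _ (x, y)) // => -[a b] [c d] [/val_inj-> /val_inj->].
have sub : is_subgraph (V, E).
  apply/forallP => x; apply/forallP => y; apply/implyP => /imsetP[[a b] ab [-> ->]].
  have [e aL bL] := sub_edgesP ab; rewrite /= !VE aL bL EE.
  have [-> _ _] := sub_edgesP e.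
  by have /forallP/(_ a)/forallP/(_ b)/implyP/(_ ab)/and4P[] := sub_pairP L.
pose M := Subgraph sub.
have iLM : iso L M.
  have fP (x : L) : val (val x) \in sub_verts M by rewrite VE; apply: valP.
  apply/isoP; exists (fun x : L => Sub (val (val x)) (fP x) : M); split.
    apply: inj_card_bij => [x y [] /val_inj/val_inj//|].
    by rewrite !card_sig /= card_imset //; apply: val_inj.
  by move=> u v; rewrite /edge /= /sub_rel /= -EE.
exists M => //; rewrite inE (nonempty_iso iLM nL) (connected_iso iLM cL) andbT /=.
apply/loop_hereditaryP => _ /imsetP[x xL ->] e.
by rewrite [_ \in _]EE; apply: lhL => //; apply: lhK => //; apply: valP.
Qed.

(** * The graph [H] as a subgraph of itself *)

Lemma full_pairP (H : lgraph) : is_subgraph ([set: H], [set p | edge p.1 p.2]).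
Proof.
apply/forallP => x; apply/forallP => y; apply/implyP; rewrite !inE /=.
by rewrite [edge y x]edge_sym => ->.
Qed.

Definition full_subgraph (H : lgraph) : subgraph H := Subgraph (full_pairP H).

Lemma full_subgraph_iso (H : lgraph) : iso (full_subgraph H) H.
Proof.
apply/isoP; exists (fun x : full_subgraph H => val x); split; last first.
  by move=> u v; rewrite /edge /= /sub_rel inE.
have xP (x : H) : x \in sub_verts (full_subgraph H) by rewrite inE.
by exists (fun x => Sub x (xP x)) => x //; apply: val_inj.
Qed.

Lemma full_subgraph_SubG (H : lgraph) : nonempty H -> connected H ->
  full_subgraph H \in SubG H.
Proof.
move=> nH cH; have i := iso_sym (full_subgraph_iso H).
rewrite inE (nonempty_iso i nH) (connected_iso i cH) andbT /=.
by apply/loop_hereditaryP => x _ e; rewrite inE.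
Qed.

(** A finite graph is isomorphic to no proper subgraph of itself: neither the vertex count nor the
    edge count of [K] exceeds that of [H], so equal sums force both to agree. *)
Lemma iso_full_subgraph (H : lgraph) (K : subgraph H) :
  iso K H -> K = full_subgraph H.
Proof.
move=> i; have := gsize_iso i.
rewrite /gsize card_sub_edges card_sig => E.
have sE : sub_edges K \subset [set p : H * H | edge p.1 p.2].
  by apply/subsetP => -[x y] /sub_edgesP[]; rewrite inE.
have leE := subset_leq_card sE; have leV := max_card (mem (sub_verts K)).
apply: subgraph_eq; apply/eqP.
  rewrite eqEcard subsetT cardsT -(leq_add2r #|sub_edges K|).
  by rewrite [X in _ <= X]E leq_add2l.
rewrite eqEcard sE -(leq_add2l #|sub_verts K|) [X in _ <= X]E.
by rewrite leq_add2r.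
Qed.

(** * Sums over representatives *)

(** Unique existence is recast as an equality of predicates, so that a sum filtered by isomorphism
    with [K] collapses to one term. *)
Lemma reps_unique (H : lgraph) (S : {set subgraph H}) (K : subgraph H) :
  is_reps S -> K \in SubG H ->
  exists2 K0 : subgraph H, iso K K0 &
    (fun K' : subgraph H => (K' \in S) && iso K K') =1 pred1 K0.
Proof.
move=> [_ rep] /rep[K0 [[K0S i] u]]; exists K0 => // K'.
by apply/andP/eqP => [[K'S i']|->//]; apply/esym/u.
Qed.

(** This allows a single term to be expanded into a sum over representatives before two summations
    are exchanged. *)
Lemma sum_reps_eq (H : lgraph) (S : {set subgraph H}) (J : lgraph)
    (F : lgraph -> int) :
  is_reps S -> (exists2 K : subgraph H, K \in SubG H & iso J K) ->
  (\sum_(K in S | iso J K) F J = F J)%R.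
Proof.
move=> rS [K KS JK]; have [K0 _ e] := reps_unique rS KS.
by rewrite (eq_bigl (pred1 K0)) ?big_pred1_eq // => K'; rewrite (iso_l K' JK).
Qed.

Lemma sum_SubG_reps (H : lgraph) (S : {set subgraph H}) (F : lgraph -> int) :
  is_reps S -> (forall J K, iso J K -> F J = F K) ->
  (\sum_(K in SubG H) F K = \sum_(K in S) (mu K)%:Z * F K)%R.
Proof.
move=> rS FI.
transitivity (\sum_(K in SubG H) \sum_(K' in S | iso K K') F K)%R.
  apply: eq_bigr => K KS; rewrite sum_reps_eq //.
  by exists K => //; apply: iso_refl.
rewrite (exchange_big_dep [in S]) /=; last by move=> ? ? _ /andP[].
(* On the class of [K'] the summand is constant, and the class has [mu K'] members. *)
apply: eq_bigr => K' K'S; rewrite (eq_bigr (fun _ => F K')); last first.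
  by move=> K /and3P[_ _ /FI].
rewrite (eq_bigl [in [set K in SubG H | iso K K']]); last first.
  by move=> K; rewrite !inE K'S.
by rewrite sumr_const -mulr_natl natz.
Qed.

(** Both sides equal the sum over isomorphic pairs ([J], [L]) in [S] and [T]. Each [L] has exactly
    one partner, as subgraphs of [K] transfer to [H]; a [J] without partner contributes zero by the
    vanishing of [F]. *)
Lemma sum_reps_sub (H : lgraph) (K : subgraph H) (S : {set subgraph H})
    (T : {set subgraph K}) (F : lgraph -> int) :
  is_reps S -> is_reps T -> K \in SubG H -> (forall J J', iso J J' -> F J = F J') ->
  (forall J : lgraph, ~~ [exists L : subgraph K, (L \in T) && iso J L] ->
     F J = 0%R) ->
  (\sum_(J in S) F J = \sum_(J in T) F J)%R.
Proof.
move=> rS rT KS FI F0; have [/subsetP TS _] := rT.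
transitivity (\sum_(J in S) \sum_(L in T | iso J L) F J)%R.
  apply: eq_bigr => J JS.
  have [/existsP[L /andP[LT JL]]|nJ] :=
    boolP [exists L : subgraph K, (L \in T) && iso J L].
    by rewrite sum_reps_eq //; exists L => //; apply: TS.
  by rewrite big1 ?F0.
rewrite (exchange_big_dep [in T]) /=; last by move=> ? ? _ /andP[].
apply: eq_bigr => L LT; rewrite -[RHS](@sum_reps_eq H S L F) //; last first.
  by have [M MS LM] := SubG_trans KS (TS _ LT); exists M.
apply: eq_big => [J|J /and3P[_ _ /FI//]].
by rewrite LT /=; congr (_ && _); apply/idP/idP; apply: iso_sym.
Qed.

(** * Vanishing of [lambda] and inversion of the hom-compaction relation *)

Lemma lambda_eq0 (S : forall H : lgraph, {set subgraph H})
    (H J : lgraph) :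
  ~~ [exists K : subgraph H, (K \in S H) && iso J K] -> lambda S H J = 0%R.
Proof. by rewrite lambdaE => ->. Qed.

Lemma lambda_gsize (S : forall H : lgraph, {set subgraph H})
    (H J : lgraph) : gsize H < gsize J -> lambda S H J = 0%R.
Proof.
move=> lt; apply: lambda_eq0; apply/existsP => -[K /andP[_ /gsize_iso E]].
by move: lt; rewrite E ltnNge gsize_sub_le.
Qed.

Theorem theorem3p8 (S : forall H : lgraph, {set subgraph H})
    (hS : forall H : lgraph, nonempty H -> connected H -> is_reps (S H))
    (H : lgraph) (H_nonempty : nonempty H) (H_connected : connected H)
    (G : lgraph) (G_nonempty : nonempty G)
    (G_irreflexive : irreflexive_graph G) (G_connected : connected G) :
  ((num_comp G H)%:Z =
   \sum_(J in S H) lambda S H J * (num_hom G J)%:Z)%R.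
Proof.
have [n] := ubnP (gsize H).
elim: n H H_nonempty H_connected => // n IH H nH cH ltn.
have rS := hS H nH cH; have [/subsetP sS _] := rS.
have homE : ((num_hom G H)%:Z = \sum_(K in S H) (mu K)%:Z * (num_comp G K)%:Z)%R.
  rewrite (num_hom_sum_comp _ G_nonempty G_connected) -natz natr_sum.
  rewrite -(@sum_SubG_reps _ _ (fun K => (num_comp G K)%:Z)%R) //.
    by apply: eq_bigr => K _; rewrite natz.
  by move=> J K /num_comp_iso->.
have subE K : K \in S H -> ~~ iso K H ->
    ((num_comp G K)%:Z = \sum_(J in S H) lambda S K J * (num_hom G J)%:Z)%R.
  move=> KS /gsize_sub lt; have := sS _ KS; rewrite inE => /and3P[nK _ cK].
  (* The induction hypothesis sums over representatives of subgraphs of [K]; the sum is moved to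
     those of [H], the new terms being zero because [lambda S K] vanishes there. *)
  rewrite IH //; last exact: leq_trans lt _.
  apply/esym; apply: (@sum_reps_sub H K (S H) (S K)
    (fun J => lambda S K J * (num_hom G J)%:Z)%R) => //.
  - exact: hS.
  - exact: sS.
  - by move=> J J' i; rewrite (lambda_iso S K i) (num_hom_iso G i).
  - by move=> J /lambda_eq0->; rewrite mul0r.
have FS := full_subgraph_SubG nH cH; have iF := full_subgraph_iso H.
have fullS : full_subgraph H \in S H.
  (* The representative [K0] of the class of [H] is isomorphic to [H], hence is the full subgraph
     itself. *)
  have [K0 iK0 e] := reps_unique rS FS.
  have /andP[+ _] : (K0 \in S H) && iso (full_subgraph H) K0 by rewrite e /= eqxx.
  rewrite (@iso_full_subgraph _ K0) //.
  exact: iso_trans (iso_sym iK0) iF.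
have isoE (K : subgraph H) : iso K H = (K == full_subgraph H).
  by apply/idP/eqP => [/iso_full_subgraph|->].
have muF : mu (full_subgraph H) = 1.
  rewrite -(cards1 (full_subgraph H)); congr #|pred_of_set _|; apply/setP => K.
  rewrite !inE -isoE; apply/andP/idP => [[_ i]|i]; first exact: iso_trans i iF.
  by rewrite (iso_full_subgraph i); split; [rewrite inE in FS | apply: iso_refl].
(* The term of the full subgraph is [num_comp G H] with coefficient one, so the relation can be
   solved for it. *)
rewrite (bigD1 (full_subgraph H)) //= muF mul1r (num_comp_iso G iF) in homE.
have {homE}-> : ((num_comp G H)%:Z = (num_hom G H)%:Z -
    \sum_(K in S H | K != full_subgraph H) (mu K)%:Z * (num_comp G K)%:Z)%R.
  by rewrite homE addrK.
(* On the other side the full subgraph contributes [num_hom G H], since its weight is one. *)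
rewrite [RHS](bigD1 (full_subgraph H)) //= (num_hom_iso G iF).
have hasS (J : subgraph H) : J \in S H ->
    [exists K : subgraph H, (K \in S H) && iso J K].
  by move=> JS; apply/existsP; exists J; rewrite JS iso_refl.
rewrite lambdaE hasS // iF mul1r; congr (_ + _)%R.
(* In the expansion for a proper [K], the term at the full subgraph drops out: that graph is larger
   than [K], so its weight is zero. *)
rewrite (eq_bigr (fun K => \sum_(J in S H | J != full_subgraph H)
    (mu K)%:Z * (lambda S K J * (num_hom G J)%:Z))%R); last first.
  move=> K /andP[KS nK]; have nI : ~~ iso K H by rewrite isoE.
  rewrite subE // (bigD1 (full_subgraph H)) //= lambda_gsize; last first.
    by rewrite (gsize_iso iF) gsize_sub.
  by rewrite mul0r add0r mulr_sumr.
(* After the exchange, the coefficient of [num_hom G J] is precisely the recursive clause for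
   [lambda S H J]. *)
rewrite exchange_big -sumrN /=; apply: eq_bigr => J /andP[JS nJ].
rewrite [in RHS]lambdaE hasS // isoE (negPf nJ) /= mulNr mulr_suml; congr (- _)%R.
by apply: eq_big => [K|K _]; rewrite ?isoE ?mulrA.
Qed.
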